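(* Let $\{x_k\}$ be a sequence of real numbers converging to $x_*$ with $x_k \neq x_*$ for all large $k$, and let $p \in \mathbb{N}$. Define $e_k = |x_k - x_*|$. Then $$\overline{Q}_1^{(p)}(x_k) = \max_{0 \leq j \leq p-1} \limsup_{i \to \infty} \left( \frac{e_{j+(i+1)p}}{e_{j+ip}} \right)^{1/p}.$$ Consequently, $\{x_k\}$ converges with $p$-step Q-order at least $\alpha$ for some $\alpha \geq 1$ if and only if there exists $c \in (0,1)$ such that each subsequence $\{e_{j+ip}\}_{i=0}^{\infty}$, $j = 0,1,\dots,p-1$, eventually (i.e. for all sufficiently large $i$) satisfies $e_{j+(i+1)p} \leq c^{p}\, e_{j+ip}$. In particular, if $\{x_k\}$ converges with $p$-step Q-order at least $\alpha$ for some $\alpha \geq 1$, then $\{e_k\}$ eventually admits no run of $p$ consecutive non-decreasing steps; that is, there exists $K'$ such that for no $k \geq K'$ does $e_k \leq e_{k+1} \leq \cdots \leq e_{k+p}$ hold.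
   Context: $\mathbb{N} = \{1,2,\dots\}$; sequences are indexed by integers $k \geq 0$. All quotients are considered for indices large enough that they are defined, and limits superior are taken in $[0,+\infty]$. For $p \in \mathbb{N}$ and $\alpha \geq 1$ define $$Q_1^{(p)}(x_k) = \left(\frac{e_{k+p}}{e_k}\right)^{1/p}, \qquad Q_\alpha^{(p)}(x_k) = \left(\frac{e_{k+p}}{e_k^{\alpha^p}}\right)^{\frac{\alpha-1}{\alpha^p-1}} \ \text{ if } \alpha>1, \qquad \overline{Q}_\alpha^{(p)}(x_k) = \limsup_{k\to\infty} Q_\alpha^{(p)}(x_k).$$ The sequence $\{x_k\}$ converges with $p$-step Q-order at least $1$ if $\overline{Q}_1^{(p)}(x_k) < 1$, and with $p$-step Q-order at least $\alpha$, for $\alpha > 1$, if $\overline{Q}_\alpha^{(p)}(x_k) < \infty$. *)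

(* Defs.v *)
From HB Require Import structures.
From mathcomp Require Export all_boot all_order all_algebra.
From mathcomp Require Export all_classical all_reals all_analysis.
Set Implicit Arguments.
Unset Strict Implicit.
Unset Printing Implicit Defensive.
Import Order.TTheory GRing.Theory Num.Theory.
Import numFieldNormedType.Exports.
Local Open Scope classical_set_scope.
Local Open Scope ring_scope.

Definition err (R : realType) (x : R^nat) (xs : R) : R^nat :=
  fun k => `|x k - xs|.

(* Division and [`^] are total, so [Qfactor] has a conventional finite value at
   the indices k with x k = xs. When there are only finitely many of them,
   these values do not affect the limit superior. It is only meant for
   [1 <= alpha] and [0 < p]. *)
Definition Qfactor (R : realType) (p : nat) (alpha : R) (x : R^nat) (xs : R)
    : R^nat := fun k =>
  let e := err x xs in
  if alpha == 1 then (e (k + p)%N / e k) `^ (p%:R^-1)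
  else (e (k + p)%N / (e k `^ (alpha ^+ p)))
         `^ ((alpha - 1) / (alpha ^+ p - 1)).

Definition Qbar (R : realType) (p : nat) (alpha : R) (x : R^nat) (xs : R)
    : \bar R := limn_esup (fun k => (Qfactor p alpha x xs k)%:E).

Definition Qorder_at_least (R : realType) (p : nat) (alpha : R) (x : R^nat)
    (xs : R) : Prop :=
  x @ \oo --> xs /\
  ((alpha = 1 /\ (Qbar p 1 x xs < 1%:E)%E) \/
   (1 < alpha /\ (Qbar p alpha x xs < +oo)%E)).

(* Main.v *)
Require Import Defs.
From mathcomp Require Import all_boot all_order all_algebra.
From mathcomp Require Import all_classical all_reals all_analysis.
Import Order.TTheory GRing.Theory Num.Theory.
Import numFieldNormedType.Exports.
Local Open Scope classical_set_scope.
Local Open Scope ring_scope.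

(* The limit superior of a sequence is below [a] exactly when the sequence is
   eventually bounded by some [b < a], and a property holds for all large [k]
   exactly when it holds eventually along each residue class modulo [p]; this
   gives the formula for [Qbar] at order 1. Order at least 1 amounts to the
   eventual contraction e_(k+p) <= c^p e_k. For alpha > 1, a bound on
   e_(k+p) / e_k^A with A = alpha^p > 1 implies such a contraction because
   e_k^(A-1) tends to 0. Finally, p non-decreasing steps from k would give
   e_k <= e_(k+p) <= c^p e_k < e_k. *)

(** [limf_esup] is an infimum of suprema over the sets of the filter: being below [a] singles out
    one such set, whose supremum serves as [b]; conversely the indices with [u n <= b] form such a
    set. *)
Lemma limn_esup_ltP (R : realType) (u : (\bar R)^nat) (a : \bar R) :
  (limn_esup u < a)%E <->
  exists2 b, (b < a)%E & \forall n \near \oo, (u n <= b)%E.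
Proof.
rewrite /limn_esup /limf_esup; split.
  move=> /ereal_inf_lt[_ [V Voo <-]] supVa.
  exists (ereal_sup (u @` V)) => //.
  by apply: filterS Voo => n Vn; apply: ereal_sup_ubound; exists n.
move=> [b ba ub]; apply: le_lt_trans ba.
apply: (le_trans (ereal_inf_lbound _)).
  by exists [set n | (u n <= b)%E]; [exact: ub|reflexivity].
by apply: ge_ereal_sup => _ [n /= unb <-].
Qed.

Lemma near_residuesP (p : nat) (P : nat -> Prop) : (0 < p)%N ->
  (\forall k \near \oo, P k) <->
  (forall j, (j < p)%N -> \forall i \near \oo, P (j + i * p)%N).
Proof.
move=> p0; split=> [[N _ NP] j jp|resP].
  exists N => // i /= Ni; apply: NP => /=.
  by rewrite (leq_trans Ni)// (leq_trans (leq_pmulr _ p0))// leq_addl.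
(* The finitely many residues share one threshold [N], and [k >= N * p] has quotient at least [N] by
   [p]. *)
have : \forall i \near \oo, forall j : 'I_p, P (j + i * p)%N.
  by apply: filter_forall => j; exact: resP.
move=> [N _ NP]; exists (N * p)%N => // k /= Nk.
rewrite (divn_eq k p) addnC.
by apply: (NP (k %/ p)%N _ (Ordinal (ltn_pmod k p0))); rewrite /= leq_divRL.
Qed.

(** Each inequality is proved by contradiction: if it failed, the bounds given by [limn_esup_ltP]
    would pass between [u] and its residue classes and make some limit superior strictly less than
    itself. *)
Lemma limn_esup_residues (R : realType) (p : nat) (u : (\bar R)^nat) :
  (0 < p)%N ->
  limn_esup u =
    \big[maxe/-oo%E]_(j < p) limn_esup (fun i : nat => u (j + i * p)%N).
Proof.
move=> p0; apply: le_anti; apply/andP; split; last first.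
  apply: bigmax_le => [|j _]; first exact: leNye.
  rewrite leNgt; apply/negP => /limn_esup_ltP[b ba ub].
  suff : (limn_esup (fun i => u (j + i * p)%N) <
          limn_esup (fun i => u (j + i * p)%N))%E by rewrite ltxx.
  apply/limn_esup_ltP; exists b => //.
  exact: ((near_residuesP p (fun k => (u k <= b)%E) p0).1 ub).
rewrite leNgt; apply/negP => /bigmax_ltP[Nya ltj].
(* Choosing a bound for every residue as data allows their maximum to be formed below. *)
have {}ltj (j : 'I_p) : {b | (b < limn_esup u)%E &
    \forall i \near \oo, (u (j + i * p)%N <= b)%E}.
  by apply: cid2; apply/limn_esup_ltP; exact: ltj.
suff : (limn_esup u < limn_esup u)%E by rewrite ltxx.
apply/limn_esup_ltP.
exists (\big[maxe/-oo%E]_(j < p) s2val (ltj j)).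
  by apply: bigmax_lt => // j _; case: (ltj j).
apply/(near_residuesP p _ p0) => j jp.
have := s2valP' (ltj (Ordinal jp)); apply: filterS => i /= /le_trans; apply.
exact: (le_bigmax _ (fun j => s2val (ltj j)) (Ordinal jp)).
Qed.

Lemma powR_le_root (R : realType) (s r c : R) : 0 < s -> 0 <= r -> 0 <= c ->
  (r `^ s <= c) = (r <= c `^ s^-1).
Proof.
move=> s0 r0 c0; have sI : s * s^-1 = 1 by rewrite divff ?gt_eqF.
have sI' : s^-1 * s = 1 by rewrite mulrC.
apply/idP/idP => H.
  rewrite -[leLHS]powRr1// -sI powRrM ge0_ler_powR ?invr_ge0 ?(ltW s0)//;
    by rewrite nnegrE ?powR_ge0.
rewrite -[leRHS]powRr1// -sI' powRrM ge0_ler_powR ?(ltW s0)//;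
  by rewrite nnegrE ?powR_ge0.
Qed.

(** The bound can be taken real: [+oo] is not below [a], and [-oo] bounds no real value. *)
Lemma limn_esup_fin_lt (R : realType) (u : R^nat) (a : \bar R) :
  (limn_esup (fun n => (u n)%:E) < a)%E ->
  exists2 b : R, (b%:E < a)%E & \forall n \near \oo, u n <= b.
Proof.
move=> /limn_esup_ltP[[b| |]].
- by move=> ba ub; exists b.
- by rewrite ltNge leey.
- move=> _ [N _ /(_ N (leqnn N))] /=.
  by rewrite leeNy_eq.
Qed.

Section contraction.
Context {R : realType} (x : R^nat) (xs : R) (p : nat).
Hypotheses (hx : x @ \oo --> xs) (hne : \forall k \near \oo, x k != xs).
Hypothesis p0 : (0 < p)%N.
Let e := err x xs.

Lemma err_ge0 k : 0 <= e k. Proof. exact: normr_ge0. Qed.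

Lemma near_err_gt0 : \forall k \near \oo, 0 < e k.
Proof.
by apply: filterS hne => k; rewrite /e /err normr_gt0 subr_eq0.
Qed.

Lemma near_err_le (d : R) : 0 < d -> \forall k \near \oo, e k <= d.
Proof.
move=> d0; have /cvgrPdist_le/(_ d d0) := hx.
by apply: filterS => k; rewrite distrC.
Qed.

Lemma Qfactor1_le (c : R) k : 0 <= c -> 0 < e k ->
  (Qfactor p 1 x xs k <= c) = (e (k + p)%N <= c ^+ p * e k).
Proof.
move=> c0 ek0; rewrite /Qfactor eqxx -/e powR_le_root ?invr_gt0 ?ltr0n//.
  by rewrite invrK powR_mulrn// ler_pdivrMr.
by rewrite divr_ge0// err_ge0.
Qed.

Lemma Qbar1_contraction : (Qbar p 1 x xs < 1%:E)%E ->
  exists c : R, [/\ 0 < c, c < 1 &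
    \forall k \near \oo, e (k + p)%N <= c ^+ p * e k].
Proof.
move=> /limn_esup_fin_lt[b]; rewrite lte_fin => b1 ub.
(* Raising [b] to at least 1/2 gives a positive constant still below 1, whatever the sign of [b]. *)
have c0 : 0 < Num.max b 2^-1 by rewrite lt_max invr_gt0 ltr0n orbT.
exists (Num.max b 2^-1); split => //.
  by rewrite gt_max b1 invf_lt1 ?ltr0n ?ltr1n.
apply: filterS2 near_err_gt0 ub => k ek0 Qb.
by rewrite -Qfactor1_le ?(ltW c0)// le_max Qb.
Qed.

Lemma contraction_Qbar1 (c : R) : 0 < c -> c < 1 ->
  (\forall k \near \oo, e (k + p)%N <= c ^+ p * e k) ->
  (Qbar p 1 x xs < 1%:E)%E.
Proof.
move=> c0 c1 ec; apply/limn_esup_ltP; exists c%:E; first by rewrite lte_fin.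
apply: filterS2 near_err_gt0 ec => k ek0 ekc.
by rewrite lee_fin Qfactor1_le// ltW.
Qed.

Lemma Qbar_superlinear (alpha : R) : 1 < alpha ->
  (Qbar p alpha x xs < +oo)%E ->
  forall d : R, 0 < d -> \forall k \near \oo, e (k + p)%N <= d * e k.
Proof.
move=> a1 /limn_esup_fin_lt[M _ ub] d d0.
set A := alpha ^+ p; set s := (alpha - 1) / (A - 1).
have A1 : 0 < A - 1 by rewrite subr_gt0 exprn_egt1// -lt0n.
have s0 : 0 < s by rewrite divr_gt0// subr_gt0.
(* [C] will bound e_(k+p) / e_k^A; dividing by [C + 1] below avoids the case [C = 0]. *)
set C := M `^ s^-1; have C1 : 0 < C + 1 by rewrite ltr_wpDl// powR_ge0.
have dC0 : 0 < d / (C + 1) by rewrite divr_gt0.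
(* This threshold on e_k is chosen so that (C + 1) e_k^(A-1) <= d. *)
have := near_err_le _ (powR_gt0 (A - 1)^-1 dC0).
apply: filterS3 near_err_gt0 ub => k ek0 QM ekd.
(* The sign of [M] is read off from a single factor, as powers are nonnegative. *)
have M0 : 0 <= M.
  by apply: le_trans QM; rewrite /Qfactor; case: ifP => _; exact: powR_ge0.
move: QM; rewrite /Qfactor gt_eqF// -/e -/A -/s powR_le_root//; last first.
  by rewrite divr_ge0 ?powR_ge0 ?err_ge0.
rewrite ler_pdivrMr ?powR_gt0// -/C => /le_trans; apply.
(* Splitting e_k^A as e_k e_k^(A-1) reduces the goal to C e_k^(A-1) <= d. *)
rewrite -mulr_powRB1 ?err_ge0//; last by rewrite (lt_trans ltr01)// -subr_gt0.
rewrite mulrCA mulrC ler_wpM2r ?err_ge0//.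
move: ekd; rewrite -powR_le_root ?err_ge0//; last exact: ltW.
rewrite ler_pdivlMr// => /(le_trans _); apply.
by rewrite mulrC ler_wpM2l ?powR_ge0// lerDl.
Qed.

Lemma Qorder_contractionP :
  (exists alpha : R, 1 <= alpha /\ Qorder_at_least p alpha x xs) <->
  (exists c : R, [/\ 0 < c, c < 1 &
    \forall k \near \oo, e (k + p)%N <= c ^+ p * e k]).
Proof.
split=> [[alpha [_ [_ [[_ /Qbar1_contraction//]|[a1 Qoo]]]]]|[c [c0 c1 ec]]].
  (* For [alpha > 1] every ratio [d] is eventually reached, so c = 1/2 with d = c^p will do. *)
  exists 2^-1; rewrite invr_gt0 invf_lt1 ?ltr0n ?ltr1n//; split=> //.
  by apply: (Qbar_superlinear _ a1 Qoo); rewrite exprn_gt0// invr_gt0.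
(* A contraction yields the weakest order, [alpha = 1]. *)
exists 1; split=> //; split=> //; left; split=> //.
exact: contraction_Qbar1 ec.
Qed.

Lemma contraction_no_run (c : R) : 0 < c -> c < 1 ->
  (\forall k \near \oo, e (k + p)%N <= c ^+ p * e k) ->
  exists K', forall k, (K' <= k)%N ->
    ~ (forall i, (i < p)%N -> e (k + i)%N <= e (k + i.+1)%N).
Proof.
move=> c0 c1 ec.
(* Positivity of e_k is what makes c^p e_k < e_k strict. *)
have [K' _ HK] : \forall k \near \oo, 0 < e k /\ e (k + p)%N <= c ^+ p * e k.
  by apply: filterS2 near_err_gt0 ec.
exists K' => k /HK[ek0 ekc] run.
have mono i : (i <= p)%N -> e k <= e (k + i)%N.
  elim: i => [|i IH] ip; first by rewrite addn0.
  exact: le_trans (IH (ltnW ip)) (run i ip).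
have := le_trans (mono p (leqnn p)) ekc.
apply/negP; rewrite -ltNge gtr_pMl//.
by rewrite exprn_ilt1 ?ltW// -lt0n.
Qed.

End contraction.

Theorem proposition4 (R : realType) (x : R^nat) (xs : R) (p : nat)
    (hx : x @ \oo --> xs) (hne : \forall k \near \oo, x k != xs)
    (hp : (0 < p)%N) :
  let e := err x xs in
  [/\ Qbar p 1 x xs =
        \big[maxe/-oo%E]_(j < p)
           limn_esup (fun i : nat =>
             ((e (j + i.+1 * p)%N / e (j + i * p)%N) `^ (p%:R^-1))%:E),
      (exists alpha : R, 1 <= alpha /\ Qorder_at_least p alpha x xs) <->
      (exists c : R, [/\ 0 < c, c < 1 &
         forall j : nat, (j < p)%N ->
           \forall i \near \oo,
             e (j + i.+1 * p)%N <= c ^+ p * e (j + i * p)%N]) &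
      (exists alpha : R, 1 <= alpha /\ Qorder_at_least p alpha x xs) ->
      exists K' : nat, forall k : nat, (K' <= k)%N ->
        ~ (forall i : nat, (i < p)%N -> e (k + i)%N <= e (k + i.+1)%N)].
Proof.
move=> e.
have shift j i : (j + i.+1 * p = j + i * p + p)%N by rewrite mulSn addnCA addnC.
split.
- rewrite /Qbar (limn_esup_residues _ _ _ hp); apply: eq_bigr => j _.
  congr limn_esup; apply/funext => i.
  by rewrite /Qfactor eqxx shift.
- rewrite Qorder_contractionP//; split=> -[c [c0 c1 ec]]; exists c; split=> //.
    move=> j jp; under eq_near do rewrite shift.
    by move/(near_residuesP p _ hp): ec; apply.
  apply/(near_residuesP p _ hp) => j jp.
  by have := ec j jp; under eq_near do rewrite shift.
- move/(Qorder_contractionP _ _ _ hx hne hp) => [c [c0 c1 ec]].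
  exact: contraction_no_run c0 c1 ec.
Qed.
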